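(* Let $R$ be a ring, $G$ a finite group acting on $R$, $H$ a subgroup of $G$, and $n\ge 0$ an integer. If the skew group ring $RG$ is an $n$-Gorenstein ring, then $RH$ is an $n$-Gorenstein ring. Moreover, if $RG$ is a separable extension over $RH$, then $RG$ is an $n$-Gorenstein ring if and only if $RH$ is an $n$-Gorenstein ring.
   Context: Rings are associative with identity; modules are unitary. $G$ acts on $R$ by ring automorphisms: $r\mapsto g(r)$ is a ring automorphism for each $g\in G$, $(g_1g_2)(r)=g_1(g_2(r))$ and $1(r)=r$. The skew group ring $RG$ is the free left $R$-module with basis $G$ and multiplication $(ag)(bh)=a\,g(b)\,gh$ for $a,b\in R$, $g,h\in G$. For a subgroup $H\le G$ (with the restricted action), $RH$ is a subring of $RG$. A ring $A$ is a separable extension over a subring $S$ if the multiplication map $A\otimes_S A\to A$, $a\otimes b\mapsto ab$, splits as a map of $A$-$A$-bimodules; i.e. there is $\sum_i a_i\otimes b_i\in A\otimes_S A$ with $\sum_i a_i\otimes b_i a=\sum_i a a_i\otimes b_i$ for all $a\in A$ and $\sum_i a_ib_i=1$. A ring $A$ is $n$-Gorenstein if it is left and right Noetherian and has injective dimension at most $n$ both as a left and as a right module over itself. *)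

(* Defs.v *)
From HB Require Import structures.
From mathcomp Require Import all_boot all_order all_algebra all_fingroup.
From mathcomp Require Import ring_quotient.
From mathcomp Require Import boolp classical_sets.
From mathcomp.multinomials Require Import freeg.
Set Implicit Arguments.
Unset Strict Implicit.
Unset Printing Implicit Defensive.
Import GRing.Theory.
Local Open Scope classical_set_scope.
Local Open Scope quotient_scope.
Local Open Scope ring_scope.

(* Rings are pzRingType (the zero ring is allowed), left A-modules are lmodType A,
   right A-modules are lmodType A^c. *)

(* Each [ring_act g] is automatically bijective, with inverse [ring_act g^-1]. *)
Record ring_action (gT : finGroupType) (R : pzRingType) := RingAction {
  ring_act :> gT -> {rmorphism R -> R};
  ring_act1 : forall r, ring_act 1%g r = r;
  ring_actM : forall g h r,
    ring_act (g * h)%g r = ring_act g (ring_act h r)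
}.

Section SkewGroupRing.
Variables (gT : finGroupType) (R : pzRingType) (a : ring_action gT R).

(* The element \sum_g x_g g is represented by the function g |-> x_g. *)
Definition skew_group_ring of ring_action gT R : Type := {ffun gT -> R}.

Local Notation RG := (skew_group_ring a).

HB.instance Definition _ := GRing.Zmodule.copy RG {ffun gT -> R}.

Implicit Types x y z : RG.

Definition skew_monomial (r : R) (g : gT) : RG :=
  [ffun k => if k == g then r else 0].

Definition skew_one : RG := skew_monomial 1 1%g.

(* The coefficient of k in (\sum_g x_g g) (\sum_h y_h h), where the monomials g, h
   with product k are those with h = g^-1 k; see skew_monomialM. *)
Definition skew_mul x y : RG :=
  [ffun k => \sum_g x g * a g (y (g^-1 * k)%g)].

Lemma skew_mulA : associative skew_mul.
Proof.
move=> x y z; apply/ffunP => k; rewrite !ffunE.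
transitivity (\sum_g \sum_h x g * (a g (y h) * a (g * h)%g (z (h^-1 * (g^-1 * k))%g))).
  apply: eq_bigr => g _; rewrite ffunE rmorph_sum big_distrr /=.
  by apply: eq_bigr => h _; rewrite rmorphM ring_actM.
transitivity (\sum_g \sum_h x h * a h (y (h^-1 * g)%g) * a g (z (g^-1 * k)%g)); last first.
  by apply: eq_bigr => g _; rewrite ffunE big_distrl.
rewrite [RHS]exchange_big /=; apply: eq_bigr => g _.
rewrite [RHS](reindex (fun h => (g * h)%g)) /=; last first.
  by exists (fun h => (g^-1 * h)%g) => h _; rewrite ?mulKg ?mulKVg.
by apply: eq_bigr => h _; rewrite mulKg invMg -!mulgA mulrA.
Qed.

Lemma skew_mul1r : left_id skew_one skew_mul.
Proof.
move=> x; apply/ffunP => k; rewrite ffunE (bigD1 1%g) //= big1 => [|g /negPf g1].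
  by rewrite ffunE eqxx mul1r invg1 mul1g ring_act1 addr0.
by rewrite ffunE g1 mul0r.
Qed.

Lemma skew_mulr1 : right_id skew_one skew_mul.
Proof.
move=> x; apply/ffunP => k; rewrite ffunE (bigD1 k) //= big1 => [|g gk].
  by rewrite ffunE mulVg eqxx rmorph1 mulr1 addr0.
rewrite ffunE; case: eqP => [/(congr1 (mulg g))|_]; last by rewrite rmorph0 mulr0.
by rewrite mulKVg mulg1 => kg; rewrite kg eqxx in gk.
Qed.

Lemma skew_mulDl : left_distributive skew_mul +%R.
Proof.
move=> x y z; apply/ffunP => k; rewrite !ffunE -big_split /=.
by apply: eq_bigr => g _; rewrite ffunE mulrDl.
Qed.

Lemma skew_mulDr : right_distributive skew_mul +%R.
Proof.
move=> x y z; apply/ffunP => k; rewrite !ffunE -big_split /=.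
by apply: eq_bigr => g _; rewrite ffunE rmorphD mulrDr.
Qed.

HB.instance Definition _ := GRing.Zmodule_isPzRing.Build RG
  skew_mulA skew_mul1r skew_mulr1 skew_mulDl skew_mulDr.

Lemma skew_mulE x y k : (x * y) k = \sum_g x g * a g (y (g^-1 * k)%g).
Proof. exact: ffunE. Qed.

Lemma skew_oneE k : (1 : RG) k = if k == 1%g then 1 else 0.
Proof. exact: ffunE. Qed.

Lemma skew_monomialM r g s h :
  skew_monomial r g * skew_monomial s h = skew_monomial (r * a g s) (g * h)%g.
Proof.
apply/ffunP => k; rewrite skew_mulE (bigD1 g) //= big1 => [|i /negPf ig].
  rewrite !ffunE eqxx addr0 -(inj_eq (mulgI g)) mulKVg.
  by case: eqP; rewrite // rmorph0 mulr0.
by rewrite ffunE ig mul0r.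
Qed.

Lemma skew_monomial_sum x : x = \sum_g skew_monomial (x g) g.
Proof.
apply/ffunP => k; rewrite sum_ffunE (bigD1 k) //= big1 => [|g /negPf gk].
  by rewrite ffunE eqxx addr0.
by rewrite ffunE eq_sym gk.
Qed.

End SkewGroupRing.

Section Subgroup.
Variables (gT : finGroupType) (R : pzRingType) (a : ring_action gT R).
Variable H : {group gT}.

Definition restr_action : ring_action (subg_of H) R :=
  @RingAction (subg_of H) R (fun h => a (sgval h))
    (ring_act1 a) (fun g h => ring_actM a (sgval g) (sgval h)).

(* The inclusion of RH into RG is extension of coefficients by zero. *)
Definition skew_incl (x : skew_group_ring restr_action) : skew_group_ring a :=
  [ffun g => if g \in H then x (subg H g) else 0].

Lemma skew_incl_is_zmod_morphism : zmod_morphism skew_incl.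
Proof. by move=> x y; apply/ffunP => g; rewrite !ffunE; case: ifP; rewrite ?subr0. Qed.

Lemma skew_incl_is_monoid_morphism : monoid_morphism skew_incl.
Proof.
split=> [|x y]; apply/ffunP => k.
  rewrite ffunE !skew_oneE; case: ifPn => [kH|].
    by rewrite -(inj_eq val_inj) /= subgK.
  by case: eqP => // ->; rewrite group1.
rewrite ffunE !skew_mulE (bigID (mem H)) /= [X in _ + X]big1 => [|g /negPf gH]; last first.
  by rewrite ffunE gH mul0r.
rewrite addr0; case: ifPn => kH; last first.
  rewrite big1 // => g gH.
  by rewrite !ffunE gH groupMl ?groupV // (negPf kH) rmorph0 mulr0.
rewrite [RHS](reindex (@sgval gT H)) /=; last first.
  by exists (subg H) => g; [rewrite sgvalK | move=> /subgK].
apply: eq_big => [g|g _]; first by rewrite subgP.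
have gH := subgP g; rewrite !ffunE gH sgvalK groupMl ?groupV // kH.
congr (_ * a _ (y _)).
by apply: val_inj; rewrite /= !subgK // groupMl ?groupV.
Qed.

HB.instance Definition _ := GRing.isZmodMorphism.Build _ _ skew_incl
  skew_incl_is_zmod_morphism.
HB.instance Definition _ := GRing.isMonoidMorphism.Build _ _ skew_incl
  skew_incl_is_monoid_morphism.

Lemma skew_incl_inj : injective skew_incl.
Proof.
move=> x y /ffunP xy; apply/ffunP => h.
by have := xy (sgval h); rewrite !ffunE subgP sgvalK.
Qed.

End Subgroup.

Section Separable.
Variables (S A : pzRingType) (iota : {rmorphism S -> A}).

(* A (x)_S A is the free abelian group on A * A modulo the subgroup generated by
   the following relators. *)
Definition tensor_relator : set {freeg (A * A)%type / int} :=
  [set u |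
    [\/ exists a a' b, u = << (a + a', b) >> - << (a, b) >> - << (a', b) >>,
        exists a b b', u = << (a, b + b') >> - << (a, b) >> - << (a, b') >> |
        exists a s b, u = << (a * iota s, b) >> - << (a, iota s * b) >> ]].

Definition tensor_null : {pred {freeg (A * A)%type / int}} :=
  fun u => `[< forall P : {pred {freeg (A * A)%type / int}},
                 zmod_closed P -> (forall v, tensor_relator v -> v \in P) ->
                 u \in P >].

Lemma tensor_null_closed : zmod_closed tensor_null.
Proof.
split=> [|u v /asboolP uI /asboolP vI]; apply/asboolP => P PZ Prel.
  exact: PZ.1.
by apply: PZ.2; [apply: uI | apply: vI].
Qed.

HB.instance Definition _ := GRing.isZmodClosed.Build _ tensor_null
  tensor_null_closed.

Definition tensor : zmodType := {ideal_quot tensor_null}.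

Definition tens (a b : A) : tensor := \pi_({ideal_quot tensor_null}) << (a, b) >>.

Lemma tens_eq0 u : tensor_relator u -> \pi_({ideal_quot tensor_null}) u = 0 :> tensor.
Proof.
move=> ru; rewrite -[0](raddf0 \pi_({ideal_quot tensor_null})).
apply/eqP; rewrite -Quotient.idealrBE subr0.
by apply/asboolP => P _; apply.
Qed.

Lemma tensDl a a' b : tens (a + a') b = tens a b + tens a' b.
Proof.
apply/eqP; rewrite -subr_eq0 opprD addrA /tens -!raddfB; apply/eqP/tens_eq0.
by constructor 1; exists a, a', b.
Qed.

Lemma tensDr a b b' : tens a (b + b') = tens a b + tens a b'.
Proof.
apply/eqP; rewrite -subr_eq0 opprD addrA /tens -!raddfB; apply/eqP/tens_eq0.
by constructor 2; exists a, b, b'.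
Qed.

Lemma tens_balanced a s b : tens (a * iota s) b = tens a (iota s * b).
Proof.
apply/eqP; rewrite -subr_eq0 /tens -raddfB; apply/eqP/tens_eq0.
by constructor 3; exists a, s, b.
Qed.

(* Writing the element of A (x)_S A as a finite sum of pure tensors a_i (x) b_i. *)
Definition separable_extension : Prop :=
  exists (m : nat) (a b : 'I_m -> A),
    (forall c, \sum_i tens (a i) (b i * c) = \sum_i tens (c * a i) (b i)) /\
    \sum_i a i * b i = 1.

End Separable.

Section Modules.
Variable A : pzRingType.

Definition noetherian_module (M : lmodType A) : Prop :=
  forall I : nat -> set M,
    (forall k, submod_closed (mem (I k))) -> (forall k, I k `<=` I k.+1) ->
    exists N, forall k, (N <= k)%N -> I k = I N.

Definition injective_module (E : lmodType A) : Prop :=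
  forall (M N : lmodType A) (f : {linear M -> N}) (g : {linear M -> E}),
    injective f -> exists h : {linear N -> E}, forall x, h (f x) = g x.

Definition exact_at (L M N : lmodType A) (f : {linear L -> M})
    (g : {linear M -> N}) : Prop :=
  forall y, g y = 0 <-> exists x, f x = y.

(* An injective resolution 0 -> M -> E 0 -> ... -> E n -> 0, continued by zeros. *)
Definition injdim_le (n : nat) (M : lmodType A) : Prop :=
  exists (E : nat -> lmodType A) (eps : {linear M -> E 0%N})
         (d : forall i, {linear E i -> E i.+1}),
    [/\ forall i, injective_module (E i),
        injective eps,
        exact_at eps (d 0%N),
        forall i, exact_at (d i) (d i.+1) &
        forall i, (n < i)%N -> forall x : E i, x = 0].

End Modules.

(* (A^c)^o is A as a right module over itself. *)
Record gorenstein (n : nat) (A : pzRingType) : Prop := Gorenstein {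
  gorenstein_left_noetherian : noetherian_module A^o;
  gorenstein_right_noetherian : noetherian_module (A^c)^o;
  gorenstein_left_injdim : injdim_le n A^o;
  gorenstein_right_injdim : injdim_le n (A^c)^o
}.

(* Main.v *)
(* RH -> RG is a Frobenius extension: the restriction of coefficients to H is an
   RH-bilinear projection RG -> RH, and representatives g_i of the left cosets of H
   together with their inverses are dual bases for it. Restriction and coinduction
   are then adjoint to each other on both sides, hence both preserve injective
   resolutions. Coinduction sends RH to RG, so RG inherits injective dimension from
   RH; restriction sends RG to a module having RH as a direct summand, so RH inherits
   it from RG. Right modules are treated by passing to the opposite rings, where the
   two dual bases are exchanged. *)
Require Import Defs.
From HB Require Import structures.
From mathcomp Require Import all_boot all_order all_algebra all_fingroup.
From mathcomp Require Import boolp classical_sets.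
Set Implicit Arguments.
Unset Strict Implicit.
Unset Printing Implicit Defensive.
Import GRing.Theory.
Local Open Scope ring_scope.

(** * Images of linear maps and factorization through surjections *)

Section LinearMaps.
Variable A : pzRingType.
Implicit Types L M N : lmodType A.

Definition mklin M N (f : M -> N) (fP : linear f) : {linear M -> N} :=
  HB.pack f (GRing.isLinear.Build A M N *:%R f fP).

(** The image, taken as a submodule of [N], stands in for the quotient of [M] by the kernel of
    [f]. *)
Lemma image_factorization M N (f : {linear M -> N}) :
  exists (K : lmodType A) (s : {linear M -> K}) (j : {linear K -> N}),
    [/\ forall z, exists x, s x = z, injective j & forall x, j (s x) = f x].
Proof.
pose P : {pred N} := fun y => `[< exists x, f x = y >].
have PZ : submod_closed P.
  split=> [|c u v /asboolP[x <-] /asboolP[y <-]]; apply/asboolP.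
    by exists 0; rewrite raddf0.
  by exists (c *: x + y); rewrite linearP.
pose PS : submodClosed N := HB.pack P (GRing.isSubmodClosed.Build A N P PZ).
pose K : lmodType A := HB.pack {x : N | x \in PS}
  [SubChoice_isSubLmodule of {x : N | x \in PS} by <:].
have fP x : f x \in PS by apply/asboolP; exists x.
pose s0 x : K := exist _ (f x) (fP x).
have sl : linear s0 by move=> c x y; apply: val_inj; rewrite /= linearP.
have jl : linear (fun z : K => val z : N) by [].
exists K, (mklin sl), (mklin jl); split=> //; last exact: val_inj.
by case=> y Py; have /asboolP[x xy] := Py; exists x; apply: val_inj.
Qed.

(** A set-theoretic section [t] of [s] suffices: [f] kills the kernel of [s], so [f (t y)] does not
    depend on the choice of [t] and is linear in [y]. *)
Lemma factor_surjection L M N (s : {linear M -> N}) (f : {linear M -> L}) :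
  (forall y, exists x, s x = y) -> (forall x, s x = 0 -> f x = 0) ->
  exists u : {linear N -> L}, forall x, u (s x) = f x.
Proof.
move=> sS sf; have [t tK] := choice sS.
have eqf x y : s x = s y -> f x = f y.
  move=> xy; apply/eqP; rewrite -subr_eq0 -linearB; apply/eqP/sf.
  by rewrite linearB xy subrr.
have ul : linear (fun y => f (t y)).
  by move=> c x y; rewrite -linearP; apply: eqf; rewrite linearP !tK.
by exists (mklin ul) => x; apply: eqf; rewrite tK.
Qed.

End LinearMaps.

(** * Injective modules and injective dimension *)

Section InjectiveDimension.
Variable A : pzRingType.
Implicit Types M N E Q : lmodType A.

Lemma injective_pair E E' :
  injective_module E -> injective_module E' -> injective_module (E * E')%type.
Proof.
move=> iE iE' M N f g fI.
have [h hf] := iE _ _ f (fst \o g : {linear M -> E}) fI.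
have [h' h'f] := iE' _ _ f (snd \o g : {linear M -> E'}) fI.
have hl : linear (fun x => (h x, h' x)).
  by move=> c u v; rewrite !linearP.
by exists (mklin hl) => x; rewrite /= hf h'f /=; case: (g x).
Qed.

Lemma injective_retract E M (i : {linear M -> E}) (p : {linear E -> M}) :
  cancel i p -> injective_module E -> injective_module M.
Proof.
move=> iK iE X Y f g fI; have [h hf] := iE _ _ f (i \o g : {linear X -> E}) fI.
by exists (p \o h : {linear Y -> M}) => x; rewrite /= hf /= iK.
Qed.

Lemma injective_injdim_le n M : injective_module M -> injdim_le n M.
Proof.
move=> iM; pose Z : lmodType A := {ffun void -> A^o}.
have Z0 (z z' : Z) : z = z' by apply/ffunP; case.
pose F i : lmodType A := if i is 0%N then M else Z.
exists F, (idfun : {linear M -> M}), (fun i => \0 : {linear F i -> F i.+1}); split.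
- by case=> [|i] // X Y f g fI; exists (\0%R : {linear Y -> Z}) => x; apply: Z0.
- by [].
- by move=> y; split=> // _; exists y.
- by move=> i y; split=> // _; exists 0; apply: Z0.
- by case=> // i _ x; apply: Z0.
Qed.

(** As [E 1] is zero, exactness makes [eps] onto, hence an isomorphism from [M] to the injective
    module [E 0]. *)
Lemma injdim_le0_injective M : injdim_le 0 M -> injective_module M.
Proof.
move=> [E [eps [d [iE epsI ex0 _ E0]]]].
have epsS y : exists x, eps x = y by apply/ex0/E0.
have eps0 x : eps x = 0 -> (idfun : {linear M -> M}) x = 0.
  by rewrite -(linear0 eps) => /epsI.
have [u uK] := factor_surjection epsS eps0.
exact: (injective_retract uK (iE 0%N)).
Qed.

(** Dimension shifting: the resolution of [Q] is spliced onto [E] by [eps \o g]. *)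
Lemma injdim_le_cokernel n M E Q (f : {linear M -> E}) (g : {linear E -> Q}) :
  injective_module E -> injective f -> exact_at f g ->
  (forall q, exists x, g x = q) -> injdim_le n Q -> injdim_le n.+1 M.
Proof.
move=> iE fI fg gS [F [eps [d [iF epsI ex0 ex F0]]]].
pose F' i : lmodType A := if i is j.+1 then F j else E.
pose d' i : {linear F' i -> F' i.+1} :=
  if i is j.+1 then d j else (eps \o g : {linear E -> F 0%N}).
exists F', f, d'; split=> //.
- by case.
- move=> y; rewrite -fg /=; split=> [|->]; last by rewrite linear0.
  by rewrite -(linear0 eps) => /epsI.
- case=> [y|i y]; last exact: ex.
  rewrite /= ex0; split=> [[q <-]|[x <-]]; last by exists (g x).
  by have [x <-] := gS q; exists x.
- by case=> // i; apply: F0.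
Qed.

Lemma injdim_leS_cokernel n M : injdim_le n.+1 M ->
  exists E Q (f : {linear M -> E}) (g : {linear E -> Q}),
    [/\ injective_module E, injective f, exact_at f g,
        forall q, exists x, g x = q & injdim_le n Q].
Proof.
move=> [E [eps [d [iE epsI ex0 ex E0]]]].
(* The image of [d 0] is the cokernel of [eps]; the remaining terms, shifted by one, resolve it. *)
have [Q [s [j [sS jI js]]]] := image_factorization (d 0%N).
exists (E 0%N), Q, eps, s; split=> //.
  move=> y; rewrite -ex0 -js; split=> [->|]; first by rewrite linear0.
  by rewrite -(linear0 j) => /jI.
exists (fun i => E i.+1), j, (fun i => d i.+1); split=> //.
- by move=> y; rewrite ex; split=> [[x <-]|[q <-]];
    [exists (s x) | have [x <-] := sS q; exists x].
- by move=> i ni; apply: E0.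
Qed.

Lemma injdim_le_pair n Q E :
  injective_module E -> injdim_le n Q -> injdim_le n (Q * E)%type.
Proof.
move=> iE [F [eps [d [iF epsI ex0 ex F0]]]].
have [n0|n_gt0] := posnP n.
  rewrite n0 in F0; apply/injective_injdim_le/injective_pair => //.
  by apply: injdim_le0_injective; exists F, eps, d.
(* The summand [E] is added in degree 0 only, where the first differential kills it. *)
pose F' i : lmodType A := if i is j.+1 then F j.+1 else (F 0%N * E)%type.
pose d' i : {linear F' i -> F' i.+1} :=
  if i is j.+1 then d j.+1 else (d 0%N \o fst : {linear (F 0%N * E)%type -> F 1%N}).
have el : linear (fun x : Q * E => (eps x.1, x.2) : F' 0%N).
  by move=> c u v; rewrite /= linearP.
exists F', (mklin el), d'; split=> //.
- by case=> [|i]; [apply: injective_pair | apply: iF].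
- by move=> [q e] [q' e'] [/epsI -> ->].
- case=> y e; rewrite /= ex0; split=> [[x <-]|[[x e'] [<- _]]]; last by exists x.
  by exists (x, e).
- case=> [y|i y]; last exact: ex.
  rewrite /= ex; split=> [[x <-]|[[x e] <-]]; last by exists x.
  by exists (x, 0).
- by case=> // i; apply: F0.
Qed.

(* Let 0 -> N -> E -> Q -> 0 be the start of a resolution and let [e] extend the
   idempotent 1 - ip of N to E. The kernel of (g, e) : E -> Q * E is M, and its
   image E/M is a retract of Q * E by (q, x) |-> [x] + [(1 - e)(g^-1 q)]. *)
Lemma injdim_le_retract n N M (i : {linear M -> N}) (p : {linear N -> M}) :
  cancel i p -> injdim_le n N -> injdim_le n M.
Proof.
elim: n => [|n IHn] in N M i p * => iK.
  by move/injdim_le0_injective => iN; apply/injective_injdim_le/(injective_retract iK).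
case/injdim_leS_cokernel=> E [Q [f [g [iE fI fg gS Qn]]]].
have [e ef] := iE _ _ f (f \o (idfun \- (i \o p)) : {linear N -> E}) fI.
have gel : linear (fun x => (g x, e x)) by move=> c u v; rewrite !linearP.
have [K [s [j [sS jI js]]]] := image_factorization (mklin gel).
have sE x y : g x = g y -> e x = e y -> s x = s y.
  by move=> gxy exy; apply: jI; rewrite !js /= gxy exy.
have g0f x : g (f x) = 0 by apply/fg; exists x.
(* If [g x = 0] then [x = f y] for some [y], and [e x = f (y - i (p y))] vanishes only when
   [y = i (p y)]. *)
have ker x : s x = 0 <-> exists m, (f \o i) m = x.
  split=> [sx|[m <-]].
    have := js x; rewrite sx linear0 => -[/esym/fg[y yx] /esym].
    rewrite -yx ef /= -{1}(linear0 f) => /fI/eqP; rewrite subr_eq0 => /eqP yE.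
    by exists (p y); rewrite /= -yE.
  by rewrite -(linear0 s); apply: sE; rewrite !linear0 ?g0f //= ef /= iK subrr linear0.
pose se : {linear E -> K} := s \o (idfun \- e).
(* On [x = f y] the map [1 - e] gives [f (i (p y))], which [s] kills; hence [se] descends to [Q]. *)
have u0 x : g x = 0 -> se x = 0.
  move=> /fg[y <-]; rewrite /= ef /= -linearB opprB addrC subrK.
  by apply/ker; exists (p y).
have [u ug] := factor_surjection gS u0.
have rl : linear (fun x : Q * E => s x.2 + u x.1).
  by move=> c x y; rewrite /= !linearP scalerDr addrACA.
(* The pair [(g x, e x)] is sent to [s (e x) + s (x - e x) = s x]. *)
have rK : cancel j (mklin rl).
  by move=> z; have [x <-] := sS z; rewrite js /= ug /= -linearD addrC subrK.
apply: (injdim_le_cokernel (f := f \o i : {linear M -> E}) (g := s)) => //.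
  by move=> x y /fI /(can_inj iK).
exact: IHn rK (injdim_le_pair iE Qn).
Qed.

End InjectiveDimension.

(* The inclusion S -> A is a Frobenius extension, [sf_proj] being its Frobenius
   homomorphism and ([sf_x], [sf_y]) a pair of dual bases, here orthonormal. *)
Record split_frobenius (S A : pzRingType) (I : finType) := SplitFrobenius {
  sf_incl : {rmorphism S -> A};
  sf_proj : {additive A -> S};
  sf_x : I -> A;
  sf_y : I -> A;
  sf_inclK : cancel sf_incl sf_proj;
  sf_projMl : forall s b, sf_proj (sf_incl s * b) = s * sf_proj b;
  sf_projMr : forall b s, sf_proj (b * sf_incl s) = sf_proj b * s;
  sf_expandl : forall b, b = \sum_i sf_x i * sf_incl (sf_proj (sf_y i * b));
  sf_expandr : forall b, b = \sum_i sf_incl (sf_proj (b * sf_x i)) * sf_y i;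
  sf_ortho : forall i j, sf_proj (sf_y i * sf_x j) = if i == j then 1 else 0
}.

Definition sf_converse S A I (F : split_frobenius S A I) :
    split_frobenius S^c A^c I.
Proof.
pose inc : {rmorphism S^c -> A^c} := HB.pack (sf_incl F : S^c -> A^c)
  (GRing.isZmodMorphism.Build S^c A^c (sf_incl F) (raddfB (sf_incl F)))
  (GRing.isMonoidMorphism.Build S^c A^c (sf_incl F)
     (conj (rmorph1 (sf_incl F)) (fun s t => rmorphM (sf_incl F) t s))).
pose proj : {additive A^c -> S^c} := HB.pack (sf_proj F : A^c -> S^c)
  (GRing.isZmodMorphism.Build A^c S^c (sf_proj F) (raddfB (sf_proj F))).
apply: (@SplitFrobenius S^c A^c I inc proj (sf_y F) (sf_x F)).
- exact: (sf_inclK F).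
- by move=> s b; apply: (sf_projMr F).
- by move=> b s; apply: (sf_projMl F).
- exact: (sf_expandr F).
- exact: (sf_expandl F).
- by move=> i j; rewrite eq_sym; apply: (sf_ortho F).
Defined.

(** * Restriction and coinduction along a Frobenius extension *)

Section SplitFrobenius.
Variables (S A : pzRingType) (I : finType) (F : split_frobenius S A I).
Local Notation iota := (sf_incl F).
Local Notation proj := (sf_proj F).
Local Notation x := (sf_x F).
Local Notation y := (sf_y F).

(** Expand [c] in the dual bases. This is the product rule for the matrices [proj (y i * b * x j)],
    through which [A] acts on coinduced modules. *)
Lemma sf_projM b c : proj (b * c) = \sum_j proj (b * x j) * proj (y j * c).
Proof.
rewrite {1}(sf_expandl F c) mulr_sumr raddf_sum.
by apply: eq_bigr => j _; rewrite mulrA sf_projMr.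
Qed.

(** A copy of [M] indexed by [F], so that its [S]-module structure depends on [iota] and stays apart
    from the [A]-module structure. *)
Definition restriction of split_frobenius S A I := fun M : lmodType A => M : Type.

Section Restriction.
Variable M : lmodType A.
Local Notation resM := (restriction F M).

HB.instance Definition _ := GRing.Zmodule.on resM.

Definition restriction_scale (s : S) (m : resM) : resM := iota s *: (m : M).

Fact restriction_scaleA s t m :
  restriction_scale s (restriction_scale t m) = restriction_scale (s * t) m.
Proof. by rewrite /restriction_scale scalerA rmorphM. Qed.

Fact restriction_scale1 : left_id 1 restriction_scale.
Proof. by move=> m; rewrite /restriction_scale rmorph1 scale1r. Qed.

Fact restriction_scaleDr : right_distributive restriction_scale +%R.
Proof. by move=> s m m'; apply: scalerDr. Qed.

Fact restriction_scaleDl m :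
  {morph restriction_scale^~ m : s t / s + t >-> s + t}.
Proof. by move=> s t; rewrite /restriction_scale rmorphD; apply: scalerDl. Qed.

HB.instance Definition _ := GRing.Zmodule_isLmodule.Build S resM
  restriction_scaleA restriction_scale1 restriction_scaleDr restriction_scaleDl.

Lemma restriction_scaleE s (m : resM) : s *: m = iota s *: (m : M) :> M.
Proof. by []. Qed.

End Restriction.

(* Hom_S(A, X), where c stands for the map sending y_i to c_i. *)
Definition coinduction of split_frobenius S A I :=
  fun X : lmodType S => {ffun I -> X} : Type.

Section Coinduction.
Variable X : lmodType S.
Local Notation coindX := (coinduction F X).

HB.instance Definition _ := GRing.Zmodule.on coindX.

(** On Hom_S(A, X), [b] sends phi to the map [a |-> phi (a * b)]; its value at [y i] comes from
    expanding [y i * b] by [sf_expandr]. *)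
Definition coinduction_scale (b : A) (c : coindX) : coindX :=
  [ffun i => \sum_j proj (y i * b * x j) *: c j].

Fact coinduction_scaleA b b' c :
  coinduction_scale b (coinduction_scale b' c) = coinduction_scale (b * b') c.
Proof.
apply/ffunP=> i; rewrite !ffunE.
transitivity (\sum_j \sum_k (proj (y i * b * x j) * proj (y j * b' * x k)) *: c k).
  apply: eq_bigr => j _; rewrite ffunE scaler_sumr.
  by apply: eq_bigr => k _; rewrite scalerA.
rewrite exchange_big; apply: eq_bigr => k _; rewrite -scaler_suml; congr (_ *: _).
by rewrite mulrA -(mulrA _ b') sf_projM; apply: eq_bigr => j _; rewrite mulrA.
Qed.

Fact coinduction_scale1 : left_id 1 coinduction_scale.
Proof.
move=> c; apply/ffunP=> i; rewrite ffunE (bigD1 i) //= big1 => [|j /negPf ji].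
  by rewrite mulr1 sf_ortho eqxx scale1r addr0.
by rewrite mulr1 sf_ortho eq_sym ji scale0r.
Qed.

Fact coinduction_scaleDr : right_distributive coinduction_scale +%R.
Proof.
move=> b c c'; apply/ffunP=> i; rewrite !ffunE -big_split.
by apply: eq_bigr => j _; rewrite ffunE scalerDr.
Qed.

Fact coinduction_scaleDl c :
  {morph coinduction_scale^~ c : b b' / b + b' >-> b + b'}.
Proof.
move=> b b'; apply/ffunP=> i; rewrite !ffunE -big_split.
by apply: eq_bigr => j _; rewrite mulrDr mulrDl raddfD scalerDl.
Qed.

HB.instance Definition _ := GRing.Zmodule_isLmodule.Build A coindX
  coinduction_scaleA coinduction_scale1 coinduction_scaleDr coinduction_scaleDl.

Lemma coinduction_scaleE b (c : coindX) i :
  (b *: c) i = \sum_j proj (y i * b * x j) *: c j.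
Proof. exact: ffunE. Qed.

Lemma coinductionDE (c c' : coindX) i : (c + c') i = c i + c' i.
Proof. exact: ffunE. Qed.

End Coinduction.

Fact restriction_map_linear (M N : lmodType A) (f : {linear M -> N}) :
  linear (f : restriction F M -> restriction F N).
Proof. by move=> s m n; rewrite !restriction_scaleE linearP. Qed.

Definition restriction_map (M N : lmodType A) (f : {linear M -> N}) :=
  mklin (restriction_map_linear f).

Fact coinduction_map_linear (X Y : lmodType S) (f : {linear X -> Y}) :
  linear (fun c : coinduction F X => [ffun i => f (c i)] : coinduction F Y).
Proof.
move=> b c c'; apply/ffunP=> i.
rewrite [LHS]ffunE coinductionDE coinduction_scaleE linearD linear_sum.
rewrite [RHS]coinductionDE coinduction_scaleE ffunE; congr (_ + _).
by apply: eq_bigr => j _; rewrite linearZ ffunE.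
Qed.

Definition coinduction_map (X Y : lmodType S) (f : {linear X -> Y}) :=
  mklin (coinduction_map_linear f).

(* The adjunction isomorphism between Hom_S(res M, X) and Hom_A(M, coind X). *)
Fact coinduction_lift_linear (M : lmodType A) (X : lmodType S)
    (h : {linear restriction F M -> X}) :
  linear (fun m : M => [ffun i => h (y i *: m)] : coinduction F X).
Proof.
move=> b m m'; apply/ffunP=> i.
rewrite coinductionDE coinduction_scaleE !ffunE scalerDr linearD.
congr (_ + _); rewrite scalerA {1}(sf_expandr F (y i * b)) scaler_suml linear_sum.
by apply: eq_bigr => j _; rewrite ffunE -scalerA -restriction_scaleE linearZ.
Qed.

(* Evaluation at 1 of the S-linear maps from A to X. *)
Fact coinduction_eval_linear (X : lmodType S) :
  linear (fun c : restriction F (coinduction F X) => \sum_j proj (x j) *: c j).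
Proof.
move=> s c c'; rewrite scaler_sumr.
under eq_bigr => j _ do rewrite (coinductionDE (s *: c) c') scalerDr restriction_scaleE.
rewrite big_split; congr (_ + _) => /=.
under eq_bigr => j _ do rewrite coinduction_scaleE scaler_sumr.
rewrite exchange_big; apply: eq_bigr => k _ /=.
(* Writing [x j] as [1 * x j] lets [sf_projM] contract the sum over [j]. *)
under eq_bigr => j _ do rewrite scalerA -mulrA -[x j]mul1r.
by rewrite -scaler_suml -sf_projM mul1r sf_projMl scalerA.
Qed.

(** By adjunction [g] becomes an [S]-linear map into [E]; it extends along [f], and the extension is
    lifted back. *)
Lemma injective_coinduction (E : lmodType S) :
  injective_module E -> injective_module (coinduction F E).
Proof.
move=> iE M N f g fI.
have [h hf] := iE _ _ (restriction_map f)
  (mklin (@coinduction_eval_linear E) \o restriction_map g : {linear _ -> _}) fI.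
exists (mklin (coinduction_lift_linear h)) => m; apply/ffunP=> i.
rewrite ffunE -linearZ (hf (y i *: m)) /= linearZ.
(* Evaluating [y i *: g m] at 1 gives coordinate [i] of [g m]: the inner sum contracts to
   [proj (y i * x k)], and only [k = i] survives. *)
under eq_bigr => j _ do rewrite coinduction_scaleE scaler_sumr.
rewrite exchange_big (eq_bigr (fun k => proj (y i * x k) *: g m k)) => [|k _] /=.
  rewrite (bigD1 i) //= [X in _ + X]big1 => [|k /negPf ki].
    by rewrite sf_ortho eqxx scale1r addr0.
  by rewrite sf_ortho eq_sym ki scale0r.
under eq_bigr => j _ do rewrite scalerA -mulrA -[x j]mul1r.
by rewrite -scaler_suml -sf_projM mul1r.
Qed.

(* Coinduction is also left adjoint to restriction, since it is isomorphic to
   tensoring with A. *)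
Lemma injective_restriction (E : lmodType A) :
  injective_module E -> injective_module (restriction F E).
Proof.
move=> iE X Y f g fI.
have gZ s z : g (s *: z) = iota s *: (g z : E) by rewrite linearZ.
(* The family [c] is read as the tensor with components [x i] and [c i], so this is the [A]-linear
   map adjoint to [g]. *)
have Gl : linear (fun c : coinduction F X => \sum_i x i *: (g (c i) : E)).
  move=> b c c'.
  under eq_bigr => i _ do rewrite coinductionDE linearD scalerDr.
  rewrite big_split; congr (_ + _) => /=.
  under eq_bigr => i _ do rewrite coinduction_scaleE linear_sum scaler_sumr.
  rewrite exchange_big scaler_sumr; apply: eq_bigr => j _ /=.
  under eq_bigr => i _ do rewrite gZ scalerA -[y i * b * x j]mulrA.
  by rewrite -scaler_suml -sf_expandl scalerA.
have fI' : injective (coinduction_map f).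
  by move=> c c' /ffunP cc'; apply/ffunP=> i; have := cc' i; rewrite !ffunE => /fI.
have [h hf] := iE _ _ (coinduction_map f) (mklin Gl) fI'.
(* The unit of the adjunction, sending [z] to 1 tensor [z]: the coordinates of 1 are
   [proj (y i)]. *)
have unitl (Z : lmodType S) :
    linear (fun z : Z => [ffun i => proj (y i) *: z] : restriction F (coinduction F Z)).
  move=> s z z'; apply/ffunP=> i.
  rewrite [RHS]coinductionDE restriction_scaleE coinduction_scaleE !ffunE scalerDr.
  congr (_ + _); under eq_bigr => j _ do rewrite ffunE scalerA -[y j]mulr1.
  by rewrite -scaler_suml -sf_projM mulr1 sf_projMr scalerA.
exists (restriction_map h \o mklin (unitl Y) : {linear _ -> _}) => z /=.
(* Naturality of the unit moves [f] inside, where [hf] applies. *)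
transitivity (h (coinduction_map f (mklin (unitl X) z))).
  by congr (h _); apply/ffunP=> i; rewrite !ffunE linearZ.
rewrite hf /=; under eq_bigr => i _ do
  rewrite ffunE gZ scalerA -[y i]mulr1.
by rewrite -scaler_suml -sf_expandl scale1r.
Qed.

(** * Transfer of injective dimension *)

Lemma injdim_le_restriction n (M : lmodType A) :
  injdim_le n M -> injdim_le n (restriction F M).
Proof.
move=> [E [eps [d [iE epsI ex0 ex E0]]]].
exists (fun i => restriction F (E i)), (restriction_map eps),
  (fun i => restriction_map (d i)); split=> //.
by move=> i; apply: injective_restriction.
Qed.

(** The underlying group is a finite power, so exactness is checked coordinatewise. *)
Lemma exact_coinduction (X Y Z : lmodType S) (f : {linear X -> Y}) (g : {linear Y -> Z}) :
  exact_at f g -> exact_at (coinduction_map f) (coinduction_map g).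
Proof.
move=> fg c; split=> [/ffunP gc|[c' <-]]; last first.
  by apply/ffunP=> i; rewrite !ffunE; apply/fg; exists (c' i).
have /choice[t tP] i : exists z, f z = c i.
  by apply/fg; have := gc i; rewrite !ffunE.
by exists [ffun i => t i]; apply/ffunP=> i; rewrite !ffunE.
Qed.

Lemma injdim_le_coinduction n (X : lmodType S) :
  injdim_le n X -> injdim_le n (coinduction F X).
Proof.
move=> [E [eps [d [iE epsI ex0 ex E0]]]].
exists (fun i => coinduction F (E i)), (coinduction_map eps),
  (fun i => coinduction_map (d i)); split.
- by move=> i; apply: injective_coinduction.
- by move=> c c' /ffunP cc'; apply/ffunP=> i; have := cc' i; rewrite !ffunE => /epsI.
- exact: exact_coinduction.
- by move=> i; apply: exact_coinduction.
- by move=> i ni c; apply/ffunP=> j; rewrite [c j]E0 // ffunE.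
Qed.

Lemma injdim_le_incl n : injdim_le n A^o -> injdim_le n S^o.
Proof.
move/injdim_le_restriction.
have il : linear (iota : S^o -> restriction F A^o).
  by move=> s t t'; rewrite rmorphD rmorphM.
have pl : linear (proj : restriction F A^o -> S^o).
  by move=> s b b'; rewrite raddfD [X in X + _]sf_projMl.
exact: (@injdim_le_retract _ _ _ _ (mklin il) (mklin pl) (sf_inclK F)).
Qed.

(** [A^o] is a retract of the coinduction of [S^o]: [b] goes to its coordinates [proj (y i * b)],
    and [sf_expandl] recovers it. *)
Lemma injdim_le_ext n : injdim_le n S^o -> injdim_le n A^o.
Proof.
move/injdim_le_coinduction.
have il : linear (fun b : A^o => [ffun i => proj (y i * b)] : coinduction F S^o).
  move=> b c c'; apply/ffunP=> i.
  rewrite coinductionDE coinduction_scaleE !ffunE mulrDr raddfD; congr (_ + _).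
  by rewrite [y i * (b *: c)]mulrA sf_projM; apply: eq_bigr => j _; rewrite ffunE.
have pl : linear (fun c : coinduction F S^o => (\sum_i x i * iota (c i) : A^o)).
  move=> b c c'.
  under eq_bigr => i _ do rewrite coinductionDE rmorphD mulrDr.
  rewrite big_split; congr (_ + _) => /=.
  under eq_bigr => i _ do rewrite coinduction_scaleE rmorph_sum mulr_sumr.
  rewrite exchange_big [RHS]mulr_sumr; apply: eq_bigr => j _ /=.
  under eq_bigr => i _ do rewrite rmorphM mulrA -[y i * b * x j]mulrA.
  by rewrite -mulr_suml -sf_expandl mulrA.
apply: (@injdim_le_retract _ _ _ _ (mklin il) (mklin pl)) => b /=.
by under eq_bigr => i _ do rewrite ffunE; rewrite -sf_expandl.
Qed.

(** * Transfer of the Noetherian condition *)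

Lemma noetherian_incl : noetherian_module A^o -> noetherian_module S^o.
Proof.
move=> nA K Kc Kinc.
(* The left ideal of [A] generated by the image of [K k], described by coordinates. *)
pose J k : set A^o := fun b => forall i, K k (proj (y i * b)).
have Ksum k (T : Type) (r : seq T) (f : T -> S) :
    (forall t, K k (f t)) -> K k (\sum_(t <- r) f t).
  have [K0 KD] := Kc k; move=> Kf.
  elim/big_ind: _ => [|s t /mem_set sK /mem_set tK|//]; apply: set_mem => //.
  by rewrite -[s]mul1r; apply: KD.
have KM k s t : K k t -> K k (s * t).
  have [K0 KD] := Kc k; move=> /mem_set tK; apply: set_mem.
  by rewrite -[_ * _]addr0; apply: KD.
have Jc k : submod_closed (mem (J k)).
  split=> [|b c c' /set_mem cJ /set_mem c'J]; apply: mem_set => i.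
    by rewrite mulr0 raddf0; have [/set_mem] := Kc k.
  rewrite mulrDr raddfD [y i * _]mulrA sf_projM.
  have [_ KD] := Kc k; apply: set_mem; rewrite -[X in X + _]mul1r.
  apply: KD; apply: mem_set => //.
  by apply: Ksum => j; apply: KM.
(* Contracting [J k] back to [S] gives [K k], so the chain [K] stops when [J] does. *)
have JK k s : J k (iota s) <-> K k s.
  split=> [sJ|sK i]; last by rewrite sf_projMr; apply: KM.
  by rewrite -(sf_inclK F s) -[iota s]mul1r sf_projM; apply: Ksum => i; apply: KM.
have Jinc k : (J k `<=` J k.+1)%classic by move=> b bJ i; apply/Kinc/bJ.
have [N JN] := nA J Jc Jinc.
exists N => k /JN JkN; apply/seteqP; split=> s /JK; first by rewrite JkN => /JK.
by rewrite -JkN => /JK.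
Qed.

(** The [f i] embed [M] in a finite power of [S]; the coordinates are treated one at a time. *)
Lemma noetherian_functionals (M : lmodType S) (f : I -> {linear M -> S^o}) :
  noetherian_module S^o -> (forall m, (forall i, f i m = 0) -> m = 0) ->
  noetherian_module M.
Proof.
move=> nS f0 J Jc Jinc.
have JB k m m' : J k m -> J k m' -> J k (m - m').
  have [_ JD] := Jc k; move=> /mem_set mJ /mem_set m'J; apply: set_mem.
  by rewrite addrC -scaleN1r JD.
have JD k m m' : J k m -> J k m' -> J k (m + m').
  have [_ JD] := Jc k; move=> /mem_set mJ /mem_set m'J; apply: set_mem.
  by rewrite -[m]scale1r JD.
have Jle k l : (k <= l)%N -> (J k `<=` J l)%classic.
  elim: l => [|l IHl]; first by rewrite leqn0 => /eqP->.
  by rewrite leq_eqVlt => /predU1P[-> //|/IHl JkJl] m /JkJl /Jinc.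
(* From some stage [N] on, elements of the chain agree on the coordinates in [r] with elements of
   [J N]. *)
have approx (r : seq I) : exists N, forall k m, (N <= k)%N -> J k m ->
    exists2 m', J N m' & forall i, i \in r -> f i (m - m') = 0.
  elim: r => [|i r [N1 N1P]].
    exists 0%N => k m _ _; exists 0 => //.
    by have [/set_mem] := Jc 0%N.
  (* The left ideal of possible values at the new coordinate once those in [r] vanish. *)
  pose K k : set S^o :=
    fun s => exists m, [/\ J k m, forall j, j \in r -> f j m = 0 & f i m = s].
  have Kc k : submod_closed (mem (K k)).
    split=> [|s _ _ /set_mem[m [mJ mr <-]] /set_mem[m' [m'J m'r <-]]]; apply: mem_set.
      exists 0; rewrite linear0; split=> // [|j _]; last by rewrite linear0.
      by have [/set_mem] := Jc k.
    exists (s *: m + m'); rewrite linearP; split=> // [|j jr].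
      by have [_ JP] := Jc k; apply: set_mem; apply: JP; apply: mem_set.
    by rewrite linearP mr // m'r // scaler0 addr0.
  have Kinc k : (K k `<=` K k.+1)%classic.
    by move=> s [m [mJ mr ms]]; exists m; split=> //; apply: Jinc.
  have [N2 N2P] := nS K Kc Kinc.
  exists (maxn N1 N2) => k m; rewrite geq_max => /andP[N1k N2k] mJ.
  (* [m1] matches [m] on [r]; [m2] below corrects coordinate [i] without disturbing [r]. *)
  have [m1 m1J m1r] := N1P _ _ N1k mJ.
  have : K k (f i (m - m1)) by exists (m - m1); split=> //; apply: JB => //; apply: Jle m1J.
  rewrite N2P // => -[m2 [m2J m2r m2i]].
  exists (m1 + m2) => [|j].
    by apply: JD; [apply: Jle m1J | apply: Jle m2J]; rewrite leq_max leqnn ?orbT.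
  rewrite opprD addrA linearB inE => /predU1P[->|jr]; first by rewrite m2i subrr.
  by rewrite m1r // m2r // subrr.
have [N NP] := approx (enum I).
exists N => k Nk; apply/seteqP; split; last exact: Jle.
move=> m mJ; have [m' m'J m'P] := NP _ _ Nk mJ.
suff /eqP: m - m' = 0 by rewrite subr_eq0 => /eqP->.
by apply: f0 => i; apply: m'P; rewrite mem_enum.
Qed.

(** The functionals [proj (b * x i)] separate points by [sf_expandr], and [A]-submodules are
    [S]-submodules. *)
Lemma noetherian_ext : noetherian_module S^o -> noetherian_module A^o.
Proof.
move=> nS.
have fl i : linear (fun b : restriction F A^o => proj ((b : A) * x i) : S^o).
  by move=> s b b'; rewrite mulrDl raddfD [s *: b]/(iota s * b) -mulrA sf_projMl.
have nA : noetherian_module (restriction F A^o).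
  apply: (noetherian_functionals (f := fun i => mklin (fl i))) => // b b0.
  rewrite [b](sf_expandr F) big1 // => i _.
  by rewrite [proj _](b0 i) rmorph0 mul0r.
move=> J Jc; apply: nA => k; have [J0 JD] := Jc k.
by split=> // s b b' bJ b'J; rewrite restriction_scaleE JD.
Qed.

End SplitFrobenius.

Lemma gorenstein_split_frobenius (S A : pzRingType) (I : finType)
    (F : split_frobenius S A I) n :
  gorenstein n A <-> gorenstein n S.
Proof.
split=> -[ln rn li ri]; split.
- exact: noetherian_incl F ln.
- exact: noetherian_incl (sf_converse F) rn.
- exact: injdim_le_incl F _ li.
- exact: injdim_le_incl (sf_converse F) _ ri.
- exact: noetherian_ext F ln.
- exact: noetherian_ext (sf_converse F) rn.
- exact: injdim_le_ext F _ li.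
- exact: injdim_le_ext (sf_converse F) _ ri.
Qed.

(** * The skew group ring as a Frobenius extension of that of a subgroup *)

Section SkewGroupRing.
Variables (gT : finGroupType) (R : pzRingType) (a : ring_action gT R).
Variable H : {group gT}.
Local Notation RG := (skew_group_ring a).
Local Notation RH := (skew_group_ring (restr_action a H)).
Implicit Types (b : RG) (s : RH) (g k : gT).

Lemma skew_mul_monomiall r g b k :
  (skew_monomial a r g * b) k = r * a g (b (g^-1 * k)%g).
Proof.
rewrite skew_mulE (bigD1 g) //= big1 => [|h /negPf hg]; last by rewrite ffunE hg mul0r.
by rewrite ffunE eqxx addr0.
Qed.

Lemma skew_mul_monomialr r g b k :
  (b * skew_monomial a r g) k = b (k * g^-1)%g * a (k * g^-1)%g r.
Proof.
have E h : (h^-1 * k == g)%g = (h == k * g^-1)%g.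
  by rewrite -(inj_eq (mulgI h)) mulKVg eq_sym -(inj_eq (mulIg g^-1%g)) mulgK.
rewrite skew_mulE (bigD1 (k * g^-1)%g) //= big1 => [|h /negPf hg]; last first.
  by rewrite ffunE E hg rmorph0 mulr0.
by rewrite ffunE E eqxx addr0.
Qed.

Lemma skew_inclE s k : skew_incl s k = if k \in H then s (subg H k) else 0.
Proof. exact: ffunE. Qed.

Definition skew_proj b : RH := [ffun h => b (sgval h)].

Fact skew_proj_is_zmod_morphism : zmod_morphism skew_proj.
Proof. by move=> b b'; apply/ffunP=> h; rewrite !ffunE. Qed.

HB.instance Definition _ := GRing.isZmodMorphism.Build RG RH skew_proj
  skew_proj_is_zmod_morphism.

Lemma skew_incl_projE b k : skew_incl (skew_proj b) k = if k \in H then b k else 0.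
Proof. by rewrite skew_inclE ffunE; case: ifP => // kH; rewrite subgK. Qed.

Lemma skew_inclK : cancel (@skew_incl _ _ a H) skew_proj.
Proof. by move=> s; apply/ffunP=> h; rewrite ffunE skew_inclE subgP sgvalK. Qed.

Lemma skew_proj_mull s b : skew_proj (skew_incl s * b) = s * skew_proj b.
Proof.
apply: skew_incl_inj; rewrite rmorphM; apply/ffunP=> k.
rewrite skew_incl_projE !skew_mulE; case: ifPn => kH.
  apply: eq_bigr => g _; rewrite skew_incl_projE skew_inclE.
  by case: ifPn => gH; rewrite ?mul0r // groupMl ?groupV // kH.
rewrite big1 // => g _; rewrite skew_incl_projE skew_inclE.
by case: ifPn => gH; rewrite ?mul0r // groupMl ?groupV // (negPf kH) rmorph0 mulr0.
Qed.

Lemma skew_proj_mulr b s : skew_proj (b * skew_incl s) = skew_proj b * s.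
Proof.
apply: skew_incl_inj; rewrite rmorphM; apply/ffunP=> k.
rewrite skew_incl_projE !skew_mulE; case: ifPn => kH.
  apply: eq_bigr => g _; rewrite skew_incl_projE skew_inclE.
  by rewrite groupMr // groupV; case: ifPn; rewrite // rmorph0 mulr0 mul0r.
rewrite big1 // => g _; rewrite skew_incl_projE skew_inclE.
by case: ifPn => gH; rewrite ?mul0r // groupMl ?groupV // (negPf kH) rmorph0 mulr0.
Qed.

(** Indexes the left cosets of [H] by their canonical representatives. *)
Definition coset_repr := {g : gT | repr (g *: H)%g == g}.

Lemma coset_repr_subproof k : repr (repr (k *: H) *: H)%g == repr (k *: H)%g.
Proof. by rewrite (lcoset_eqP (mem_repr k (lcoset_refl H k))). Qed.

Definition coset_repr_of k : coset_repr :=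
  exist (fun g => repr (g *: H)%g == g) _ (coset_repr_subproof k).

Lemma coset_repr_mem (c : coset_repr) k :
  ((sval c)^-1 * k \in H)%g = (c == coset_repr_of k).
Proof.
rewrite -mem_lcoset -(inj_eq val_inj) /=; apply/idP/eqP => [kc|->].
  by rewrite (lcoset_eqP kc) (eqP (valP c)).
by rewrite -lcoset_sym (mem_repr k) // lcoset_refl.
Qed.

Definition skew_coset_l (c : coset_repr) : RG := skew_monomial a 1 (sval c).
Definition skew_coset_r (c : coset_repr) : RG := skew_monomial a 1 (sval c)^-1%g.

(** The term of [c] is the part of [b] supported on the left coset of [c], and these cosets
    partition the group. *)
Lemma skew_expandl b :
  b = \sum_c skew_coset_l c * skew_incl (skew_proj (skew_coset_r c * b)).
Proof.
apply/ffunP=> k; rewrite sum_ffunE (bigD1 (coset_repr_of k)) //= big1 => [|c].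
  rewrite skew_mul_monomiall skew_incl_projE coset_repr_mem eqxx.
  by rewrite skew_mul_monomiall !mul1r -ring_actM mulgV ring_act1 invgK mulKVg addr0.
rewrite -coset_repr_mem skew_mul_monomiall skew_incl_projE => /negPf->.
by rewrite rmorph0 mulr0.
Qed.

Lemma skew_expandr b :
  b = \sum_c skew_incl (skew_proj (b * skew_coset_l c)) * skew_coset_r c.
Proof.
(* The term of [c] now lives on the right coset of its inverse; inversion turns this into a left
   coset, hence [k^-1]. *)
have E (c : coset_repr) k : (k * sval c \in H)%g = (c == coset_repr_of k^-1%g).
  by rewrite -coset_repr_mem -groupV invMg.
apply/ffunP=> k; rewrite sum_ffunE (bigD1 (coset_repr_of k^-1%g)) //= big1 => [|c].
  rewrite skew_mul_monomialr invgK skew_incl_projE E eqxx.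
  by rewrite skew_mul_monomialr mulgK !rmorph1 !mulr1 addr0.
by rewrite -E skew_mul_monomialr invgK skew_incl_projE => /negPf->; rewrite mul0r.
Qed.

Lemma skew_ortho c c' :
  skew_proj (skew_coset_r c * skew_coset_l c') = if c == c' then 1 else 0.
Proof.
rewrite skew_monomialM rmorph1 mulr1; apply/ffunP=> h.
rewrite ffunE [skew_monomial _ _ _ _]ffunE.
have cE : coset_repr_of (sval c') = c' by apply: val_inj; apply/eqP/(valP c').
have [->|cc'] := eqVneq c c'; first by rewrite mulVg skew_oneE -(inj_eq val_inj).
(* Distinct representatives [c], [c'] have [c^-1 * c'] outside [H], so [h] cannot equal it. *)
case: eqP => hE; last by rewrite ffunE.
by have := subgP h; rewrite hE coset_repr_mem cE (negPf cc').
Qed.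

Definition skew_split_frobenius : split_frobenius RH RG coset_repr :=
  @SplitFrobenius RH RG coset_repr (@skew_incl _ _ a H) skew_proj
    skew_coset_l skew_coset_r skew_inclK skew_proj_mull skew_proj_mulr
    skew_expandl skew_expandr skew_ortho.

End SkewGroupRing.

Theorem corollary7p4 (R : pzRingType) (gT : finGroupType)
    (a : ring_action gT R) (H : {group gT}) (n : nat) :
  (gorenstein n (skew_group_ring a) ->
   gorenstein n (skew_group_ring (restr_action a H))) /\
  (separable_extension (skew_incl (H := H) : {rmorphism _ -> skew_group_ring a}) ->
   (gorenstein n (skew_group_ring a) <->
    gorenstein n (skew_group_ring (restr_action a H)))).
Proof.
have RG_RH := gorenstein_split_frobenius (skew_split_frobenius a H) n.
by split=> [/RG_RH|_].
Qed.
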